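(* Let $\lambda,\mu,\alpha>0$ and let $\xi(t)$, $t\ge 0$, be the Poisson process with uniform catastrophes with parameters $\lambda,\mu,\alpha$ (defined in the context). Let $\varphi:(0,\infty)\to(0,\infty)$ be a function with $\varphi(T)\to\infty$ as $T\to\infty$, and suppose there is $k>0$ such that $\lim_{T\to\infty}\varphi(T)/T=k$. Then the family of random variables $\xi_T(1):=\xi(T)/\varphi(T)$ satisfies the large deviation principle on $\mathbb{R}$ with normalizing function $\psi(T)=\varphi(T)$ and rate function $$ J_k(x)=\begin{cases}\infty, & x\in(-\infty,0),\\ x\ln\left(\frac{\lambda+\mu}{\lambda}\right), & x\in\left[0,\frac{\alpha}{k}\right),\\ x\ln\left(\frac{kx(\lambda+\mu)}{\alpha\lambda}\right)-x+\frac{\alpha}{k}, & x\in\left[\frac{\alpha}{k},\infty\right).\end{cases} $$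
   Context: Poisson process with uniform catastrophes: let $\eta(n)$, $n\in\mathbb{Z}^+=\{0,1,2,\dots\}$, be a Markov chain on $\mathbb{Z}^+$ with $\eta(0)=0$ and transition probabilities $\mathbf{P}(\eta(n+1)=j\mid\eta(n)=i)=\frac{\lambda}{\lambda+\mu}$ if $j=i+1$ (and $i\ge 1$), $=\frac{\mu}{i(\lambda+\mu)}$ if $0\le j<i$, $i\neq0$, and $=1$ if $i=0$, $j=1$. Let $\nu(t)$, $t\ge0$, be a Poisson process with rate $\alpha$, independent of $\eta$. Set $\xi(t):=\eta(\nu(t))$. Large deviation principle (LDP): a family of real random variables $X_T$ satisfies the LDP with rate function $I:\mathbb{R}\to[0,\infty]$ and normalizing function $\psi(T)\to\infty$ if for every $c\ge0$ the set $\{x: I(x)\le c\}$ is compact, and for every Borel set $B\subseteq\mathbb{R}$, $\limsup_{T\to\infty}\frac{1}{\psi(T)}\ln\mathbf{P}(X_T\in B)\le -I([B])$ and $\liminf_{T\to\infty}\frac{1}{\psi(T)}\ln\mathbf{P}(X_T\in B)\ge -I((B))$, where $[B]$ and $(B)$ denote closure and interior, $I(B)=\inf_{x\in B}I(x)$ and $I(\emptyset)=\infty$. *)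

(* Defs.v *)
From HB Require Import structures.
From mathcomp Require Import all_boot all_order all_algebra.
From mathcomp Require Import all_classical all_reals all_analysis.
Set Implicit Arguments. Unset Strict Implicit. Unset Printing Implicit Defensive.
Import Order.TTheory GRing.Theory Num.Theory.
Import numFieldNormedType.Exports.
Local Open Scope classical_set_scope.
Local Open Scope ring_scope.

Section PUC.
Variable R : realType.

Definition puc_trans (lam mu : R) (i j : nat) : R :=
  if i == 0%N then (j == 1%N)%:R
  else if j == i.+1 then lam / (lam + mu)
  else if (j < i)%N then mu / (i%:R * (lam + mu))
  else 0.

(* eta_dist lam mu m j = P(eta(m) = j), with eta(0) = 0 (Chapman-Kolmogorov). *)
Fixpoint eta_dist (lam mu : R) (m : nat) : nat -> \bar R :=
  match m with
  | 0%N => fun j => ((j == 0%N)%:R)%:E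
  | m'.+1 => fun j =>
      (\sum_(0 <= i <oo) (eta_dist lam mu m' i * (puc_trans lam mu i j)%:E))%E
  end.

(* P(xi(T) = n) where xi(T) = eta(nu(T)), nu a Poisson process of rate alpha
   independent of eta. *)
Definition xi_prob (lam mu alpha T : R) (n : nat) : \bar R :=
  (\sum_(0 <= m <oo)
     ((expR (- (alpha * T)) * (alpha * T) ^+ m / (m`!)%:R)%:E
        * eta_dist lam mu m n))%E.

Definition xiT_prob (lam mu alpha : R) (phi : R -> R) (T : R) (B : set R)
  : \bar R :=
  (\sum_(0 <= n <oo) ((\1_B (n%:R / phi T))%:E * xi_prob lam mu alpha T n))%E.

Definition eln (x : \bar R) : \bar R :=
  match x with
  | EFin r => if 0 < r then (ln r)%:E else -oo%E
  | +oo%E => +oo%E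
  | -oo%E => -oo%E
  end.

Definition LDP (X : R -> set R -> \bar R) (I : R -> \bar R) (psi : R -> R)
  : Prop :=
  (forall c : R, 0 <= c -> compact [set x | (I x <= c%:E)%E]) /\
  (forall B : set R, measurable B ->
     (limf_esup (fun T => ((psi T)^-1)%:E * eln (X T B))%E (pinfty_nbhs R)
        <= - ereal_inf (I @` closure B))%E /\
     (- ereal_inf (I @` interior B)
        <= limf_einf (fun T => ((psi T)^-1)%:E * eln (X T B))%E (pinfty_nbhs R))%E).

Definition J_rate (lam mu alpha k : R) (x : R) : \bar R :=
  if x < 0 then +oo%E
  else if x < alpha / k then (x * ln ((lam + mu) / lam))%:E
  else (x * ln (k * x * (lam + mu) / (alpha * lam)) - x + alpha / k)%:E.

End PUC.

(* Main.v *)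
(** Write rho = lam / (lam + mu).  Uniformly in time, P(eta(m) = n) decays like
rho^n: above by a drift inequality with the weight r^n for any r > rho, since a
state j is entered by a catastrophe only from states i > j, each with
probability at most (1 - rho) / j; below because tightness gives eta a positive
chance of being at 1 (through i -> i+1 -> i+2 -> 1) at any time, from where it
climbs to n without catastrophe.  As eta(m) <= m, the event xi(T) = n moreover
forces nu(T) >= n.  The cost of n ~ x phi(T) is thus x ln(1/rho) plus the
Poisson cost of nu(T) ~ max(x, alpha/k) phi(T), which vanishes when
x <= alpha/k.  The upper bound is Chernoff's with tilt
z = max(x, alpha/k) / (alpha/k); the lower bound keeps a single term of the
Poisson mixture. *)

Require Import Defs.
From HB Require Import structures.
From mathcomp Require Import all_boot all_order all_algebra.
From mathcomp Require Import all_classical all_reals all_analysis.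
From mathcomp Require Import ring lra.
Set Implicit Arguments.
Unset Strict Implicit.
Unset Printing Implicit Defensive.
Import Order.TTheory GRing.Theory Num.Theory.
Import numFieldNormedType.Exports.
Local Open Scope classical_set_scope.
Local Open Scope ring_scope.

(** * The embedded chain: transition probabilities and law as finite sums *)

Section Chain.
Context {R : realType} (lam mu rho : R).
Hypotheses (lam_gt0 : 0 < lam) (mu_gt0 : 0 < mu).
Hypothesis rhoE : lam / (lam + mu) = rho.

(** Real-valued form of [eta_dist]: after [m'] steps the chain is at most [m'], so the
    Chapman-Kolmogorov sum can stop there. *)
Fixpoint eta_prob (m : nat) : nat -> R :=
  match m with
  | 0%N => fun j => (j == 0%N)%:R
  | m'.+1 => fun j =>
      \sum_(0 <= i < m'.+1) eta_prob m' i * puc_trans lam mu i j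
  end.

Let rho_gt0 : 0 < rho.
Proof. by rewrite -rhoE divr_gt0// addr_gt0. Qed.

Let rho_lt1 : rho < 1.
Proof. by rewrite -rhoE ltr_pdivrMr ?addr_gt0// mul1r ltrDl. Qed.

Let rho_ge0 : 0 <= rho. Proof. exact: ltW. Qed.

Let cat_ge0 : 0 <= 1 - rho. Proof. by rewrite subr_ge0 ltW. Qed.

Let muE : mu / (lam + mu) = 1 - rho.
Proof. by rewrite -rhoE; field; rewrite gt_eqF// addr_gt0. Qed.

Lemma puc_trans_ge0 i j : 0 <= puc_trans lam mu i j.
Proof.
rewrite /puc_trans; case: ifP => _; first by case: (j == _).
case: ifP => _; first by rewrite rhoE ltW.
by case: ifP => // _; rewrite divr_ge0 ?mulr_ge0 ?addr_ge0 ?ler0n ?ltW.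
Qed.

Lemma puc_trans_up i : rho <= puc_trans lam mu i i.+1.
Proof.
by rewrite /puc_trans; case: eqP => [->|_]; rewrite eqxx ?rhoE//; exact: ltW.
Qed.

Lemma puc_trans_down i j : (j < i)%N -> puc_trans lam mu i j = (1 - rho) / i%:R.
Proof.
move=> ji; rewrite /puc_trans ifN; last by rewrite -lt0n (leq_ltn_trans _ ji).
rewrite ifN ?ji; last by rewrite ltn_eqF// ltnS ltnW.
by rewrite -muE; field; rewrite pnatr_eq0 -lt0n (leq_ltn_trans _ ji)//= gt_eqF// addr_gt0.
Qed.

Lemma puc_trans0 i j : (i.+1 < j)%N -> puc_trans lam mu i j = 0.
Proof.
move=> ij; rewrite /puc_trans; case: eqP ij => [->|_] ij.
  by rewrite gtn_eqF.
by rewrite gtn_eqF// ltnNge (ltnW (ltnW ij)).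
Qed.

Lemma sum_puc_trans i n : (i.+1 < n)%N ->
  \sum_(0 <= j < n) puc_trans lam mu i j = 1.
Proof.
move=> i_n; rewrite (big_cat_nat (n := i.+2))//=.
rewrite [X in _ + X]big_nat_cond [X in _ + X]big1 ?addr0; last first.
  by move=> j /andP[/andP[ij _] _]; exact: puc_trans0.
rewrite !big_nat_recr//=.
have -> : \sum_(0 <= j < i) puc_trans lam mu i j =
          \sum_(0 <= j < i) ((1 - rho) / i%:R).
  by apply: eq_big_nat => j /andP[_ ji]; exact: puc_trans_down.
rewrite sumr_const_nat subn0 /puc_trans.
case: eqP => [->|/eqP i0]; first by rewrite mulr0n !add0r.
rewrite ltnn eqxx (ltn_eqF (ltnSn i)) addr0 -[X in X + _]mulr_natr rhoE.
by field; rewrite pnatr_eq0.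
Qed.

Lemma eta_prob_ge0 m j : 0 <= eta_prob m j.
Proof.
elim: m j => [|m IH] j /=; first by case: (j == _).
by apply: sumr_ge0 => i _; rewrite mulr_ge0// puc_trans_ge0.
Qed.

Lemma eta_prob_supp {m j} : (m < j)%N -> eta_prob m j = 0.
Proof.
elim: m j => [|m IH] j mj; first by rewrite /= gtn_eqF.
rewrite [LHS]/= big_nat_cond big1// => i /andP[/andP[_ im] _].
by rewrite puc_trans0 ?mulr0// (leq_ltn_trans _ mj).
Qed.

Lemma sum_eta_prob m n : (m < n)%N -> \sum_(0 <= j < n) eta_prob m j = 1.
Proof.
elim: m n => [|m IH] n mn.
  case: n mn => // n _; rewrite big_nat_recl//= big1 ?addr0//.
rewrite [LHS]/= exchange_big_nat/= -[RHS](IH _ (ltnSn m)).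
apply: eq_big_nat => i /andP[_ im].
by rewrite -mulr_sumr sum_puc_trans ?mulr1// (leq_ltn_trans im).
Qed.

Lemma nneseries_finite (f : nat -> \bar R) N :
  (forall i, 0 <= f i)%E -> (forall i, (N <= i)%N -> f i = 0%E) ->
  (\sum_(0 <= i <oo) f i = \sum_(0 <= i < N) f i)%E.
Proof.
move=> f0 fN; rewrite (nneseries_split _ N)//= add0n [X in (_ + X)%E]eseries0 ?adde0//.
by move=> i Ni _; exact: fN.
Qed.

Lemma eta_distE m j : eta_dist lam mu m j = (eta_prob m j)%:E.
Proof.
elim: m j => [//|m IH] j /=.
rewrite (@nneseries_finite _ m.+1).
- by rewrite -sumEFin; apply: eq_bigr => i _; rewrite IH EFinM.
- by move=> i; rewrite IH -EFinM lee_fin mulr_ge0 ?eta_prob_ge0 ?puc_trans_ge0.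
- by move=> i mi; rewrite IH eta_prob_supp// mul0e.
Qed.

Lemma eta_prob_step m i j :
  eta_prob m i * puc_trans lam mu i j <= eta_prob m.+1 j.
Proof.
have [im|mi] := leqP i m; last first.
  by rewrite eta_prob_supp// mul0r eta_prob_ge0.
rewrite [leRHS]/= big_mkord (bigD1 (Ordinal (im : i < m.+1)%N))//= lerDl.
by apply: sumr_ge0 => k _; rewrite mulr_ge0 ?eta_prob_ge0 ?puc_trans_ge0.
Qed.

(** Only the path that climbs at each of the [n] steps is kept; a climb has probability [rho], or 1
    from state 0. *)
Lemma eta_prob_climb m i n : rho ^+ n * eta_prob m i <= eta_prob (m + n) (i + n).
Proof.
elim: n => [|n IH]; first by rewrite !addn0 mul1r.
rewrite !addnS (le_trans _ (eta_prob_step _ (i + n) _))// mulrC exprSr mulrA.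
rewrite ler_pM ?mulr_ge0 ?eta_prob_ge0 ?exprn_ge0//.
  by rewrite mulrC.
exact: puc_trans_up.
Qed.

(** * Geometric bounds on the law of the chain, uniform in time *)

Lemma geometric_tail (r : R) j n : 0 < r < 1 ->
  \sum_(0 <= i < n | (j <= i)%N) r ^+ i <= r ^+ j / (1 - r).
Proof.
move=> /andP[r0 r1]; have r1' : 0 < 1 - r by rewrite subr_gt0.
have [jn|nj] := leqP j n; last first.
  rewrite big_nat_cond big1 ?divr_ge0 ?exprn_ge0 ?ltW//.
  by move=> i /andP[/andP[_ i_n] ji]; have := leq_ltn_trans ji i_n; rewrite ltnNge ltnW.
rewrite -(big_nat_widenl j 0 n xpredT)// ler_pdivlMr// mulr_suml.
rewrite (telescope_sumr_eq (fun i => - r ^+ i))//; first last.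
  by move=> i _; rewrite exprS; ring.
by rewrite opprK addrC lerBlDr lerDl exprn_ge0// ltW.
Qed.

(** Induction on [m], with [C] so large that the bound exceeds 1 up to state [N]. Into a state [j]
    beyond [N], the climb contributes [rho / r] times the target bound and the catastrophes a
    multiple of order [1 / j] of it; as [rho < r], these add up to at most the target for [j]
    large. *)
Lemma eta_prob_le r : rho < r < 1 ->
  exists2 C, 0 < C & forall m j, eta_prob m j <= C * r ^+ j.
Proof.
move=> /andP[rho_r r1]; have r0 : 0 < r by exact: lt_trans rho_r.
have r1' : 0 < 1 - r by rewrite subr_gt0.
(* From [A] on, [rho + (1 - rho) * r / ((1 - r) * j) <= r], which closes the induction. *)
pose A := (1 - rho) * r / ((r - rho) * (1 - r)).
(* The offset puts [N] above [A] and keeps the source of the climb away from state 0, where a climb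
   has probability 1 instead of [rho]. *)
pose N := (Num.truncn A).+2.
have eta1 m j : eta_prob m j <= 1.
  have [mj|jm] := ltnP m j; first by rewrite eta_prob_supp.
  rewrite -(@sum_eta_prob m m.+1)// big_mkord.
  rewrite (bigD1 (Ordinal (jm : j < m.+1)%N))//= lerDl.
  by apply: sumr_ge0 => i _; exact: eta_prob_ge0.
have C0 : 0 < r ^- N by rewrite invr_gt0 exprn_gt0.
exists (r ^- N) => //.
have small m j : (j <= N)%N -> eta_prob m j <= r ^- N * r ^+ j.
  move=> jN; apply: le_trans (eta1 m j) _.
  by rewrite mulrC ler_pdivlMr ?exprn_gt0// mul1r ler_wiXn2l// ltW.
elim=> [|m IH] j.
  case: j => [|j]; first exact: small.
  by rewrite /= mulr_ge0 ?exprn_ge0 ?ltW.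
have [/small//|] := leqP j N; case: j => // j Nj.
have AN : A <= j.+1%:R.
  apply: ltW; apply: lt_le_trans (truncnS_gt A) _.
  by rewrite ler_nat -ltnS ltnW// ltnW.
have j0 : (0 < j.+1%:R :> R) by [].
(* State [j.+1] is entered by a climb from [j] or by a catastrophe from some [i > j.+1], of
   probability [(1 - rho) / i <= (1 - rho) / j.+1]. *)
apply: (@le_trans _ _ (rho * (r ^- N * r ^+ j) + (1 - rho) / j.+1%:R *
    \sum_(0 <= i < m.+1 | (j.+1 <= i)%N) (r ^- N * r ^+ i))).
  apply: (@le_trans _ _ (rho * eta_prob m j + (1 - rho) / j.+1%:R *
    \sum_(0 <= i < m.+1 | (j.+1 <= i)%N) eta_prob m i)); last first.
    rewrite lerD ?ler_wpM2l ?divr_ge0//.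
    by apply: ler_sum => i _; exact: IH.
  rewrite [leLHS]/= (bigID (fun i => (j.+1 <= i)%N))/= addrC lerD//; last first.
    (* The source [i = j.+1] has transition probability 0 and is kept only to make the tail start at
       [j.+1]. *)
    rewrite mulr_sumr; apply: ler_sum => i; rewrite leq_eqVlt => /orP[/eqP <-|ji].
      rewrite mulrC ler_wpM2r ?eta_prob_ge0//.
      rewrite /puc_trans /= ltnn ltn_eqF// divr_ge0//.
    rewrite mulrC ler_wpM2r ?eta_prob_ge0// puc_trans_down//.
    rewrite ler_wpM2l// lef_pV2 ?posrE// ?ltr0n ?(leq_ltn_trans _ ji)//.
    by rewrite ler_nat ltnW.
  have [jm|mj] := leqP j m; last first.
    rewrite [leLHS]big_nat_cond big1 ?mulr_ge0 ?eta_prob_ge0//.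
    move=> i /andP[/andP[_ im] _]; rewrite puc_trans0 ?mulr0// ltnS.
    by rewrite (leq_ltn_trans _ mj).
  rewrite big_mkord (bigD1 (Ordinal (jm : j < m.+1)%N))/= ?ltnn//.
  rewrite big1 ?addr0; last first.
    move=> i /andP[]; rewrite -leqNgt => ij /eqP ij'.
    rewrite puc_trans0 ?mulr0// ltnS ltn_neqAle ij andbT.
    by apply/eqP => E; apply: ij'; exact/val_inj.
  rewrite mulrC ler_wpM2r ?eta_prob_ge0// /puc_trans eqxx.
  by case: eqP Nj => [->|]//; rewrite rhoE.
rewrite -mulr_sumr.
apply: (@le_trans _ _ (rho * (r ^- N * r ^+ j) + (1 - rho) / j.+1%:R *
    (r ^- N * (r ^+ j.+1 / (1 - r))))).
  rewrite lerD2l ler_wpM2l ?divr_ge0//.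
  by rewrite ler_wpM2l ?(ltW C0)// geometric_tail// r0.
have -> : rho * (r ^- N * r ^+ j) + (1 - rho) / j.+1%:R *
    (r ^- N * (r ^+ j.+1 / (1 - r))) =
  r ^- N * r ^+ j * (rho + (1 - rho) * r / (1 - r) / j.+1%:R).
  rewrite (exprS r j); move: (r ^- N) (r ^+ j) (j.+1%:R : R) j0 => a b c c0.
  by field; rewrite !gt_eqF.
rewrite [X in _ <= _ * X]exprSr mulrA ler_wpM2l ?mulr_ge0 ?exprn_ge0 ?(ltW C0) ?(ltW r0)//.
rewrite -lerBrDl ler_pdivrMr//.
move: AN; rewrite /A ler_pdivrMr ?mulr_gt0 ?subr_gt0// => AN.
by rewrite ler_pdivrMr//; lra.
Qed.

(* State 1 is reached from every [i] in exactly three steps,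
   [i -> i.+1 -> i.+2 -> 1], whatever the parity of the elapsed time. *)
Lemma eta_prob_ge : exists2 c, 0 < c & forall m n, (n.+3 <= m)%N ->
  c * rho ^+ n <= eta_prob m n.+1.
Proof.
have /andP[r_gt r_lt] : rho < (rho + 1) / 2 < 1 by have := rho_lt1 => ?; apply/andP; split; lra.
have [|C C0 HC] := @eta_prob_le ((rho + 1) / 2); first by rewrite r_gt.
set r := (rho + 1) / 2 in r_gt r_lt HC.
have r0 : 0 < r by exact: lt_trans r_gt.
(* Tightness: at every time, the states from [N] on carry mass at most 1/2. *)
have [N HN] : exists N, C * (r ^+ N / (1 - r)) <= 1 / 2.
  have : geometric (C / (1 - r)) r n @[n --> \oo] --> (0 : R).
    by apply: cvg_geometric; rewrite gtr0_norm.
  move=> /cvgr_le/(_ (1 / 2)) [|N _ HN]; first by rewrite divr_gt0.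
  exists N; have := HN N (leqnn N); rewrite /geometric /=.
  by rewrite mulrAC mulrA.
have tight m : 1 / 2 <= \sum_(0 <= i < m.+1 | (i < N)%N) eta_prob m i.
  have := @sum_eta_prob m m.+1 (ltnSn m).
  rewrite (bigID (fun i => (i < N)%N))/=.
  suff : \sum_(0 <= i < m.+1 | ~~ (i < N)%N) eta_prob m i <= 1 / 2 by lra.
  apply: le_trans HN; apply: le_trans (ler_wpM2l (ltW C0) (@geometric_tail r N m.+1 _)); last by rewrite r0.
  rewrite mulr_sumr; under eq_bigl do rewrite -leqNgt.
  by apply: ler_sum => i _; exact: HC.
(* Two climbs from [i < N], then a catastrophe from [i.+2] to 1, of probability at least
   [(1 - rho) / N.+2]. *)
pose c := rho ^+ 2 * ((1 - rho) / (N.+2)%:R).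
have c0 : 0 < c by rewrite mulr_gt0 ?exprn_gt0 ?divr_gt0 ?subr_gt0.
have one m : c / 2 <= eta_prob (m + 3) 1.
  have -> : eta_prob (m + 3) 1 =
      \sum_(0 <= i < m.+3) eta_prob m.+2 i * puc_trans lam mu i 1.
    by rewrite addn3.
  (* Sources 0 and 1 are dropped; every other one is some [i.+2], reached from [i] by two climbs. *)
  rewrite big_nat_recl// big_nat_recl//.
  apply: (@le_trans _ _ (\sum_(0 <= i < m.+1) eta_prob m.+2 i.+2 * puc_trans lam mu i.+2 1)); last first.
    by rewrite addrA lerDr addr_ge0// mulr_ge0 ?eta_prob_ge0 ?puc_trans_ge0.
  rewrite (bigID (fun i => (i < N)%N)) ler_wpDr//.
    by apply: sumr_ge0 => i _; rewrite mulr_ge0 ?eta_prob_ge0 ?puc_trans_ge0.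
  apply: (@le_trans _ _ (\sum_(0 <= i < m.+1 | (i < N)%N) c * eta_prob m i)).
    by rewrite -mulr_sumr ler_wpM2l ?(ltW c0)// -div1r.
  apply: ler_sum => i iN; rewrite /c mulrAC ler_pM//.
  - by rewrite mulr_ge0 ?exprn_ge0 ?eta_prob_ge0 ?ltW.
  - by rewrite divr_ge0 ?subr_ge0 ?ltW.
  - by have := eta_prob_climb m i 2; rewrite !addn2.
  - rewrite puc_trans_down// ler_wpM2l//.
    by rewrite lef_pV2 ?posrE// ler_nat !ltnS ltnW.
exists (c / 2) => [|m n nm]; first by rewrite divr_gt0.
(* The chain is at 1 at time [m - n >= 3], then climbs [n] times. *)
have := eta_prob_climb (m - n) 1 n.
rewrite subnK ?(leq_trans _ nm)// ?add1n; last by rewrite -addn3 leq_addr.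
apply: le_trans; rewrite mulrC ler_wpM2l ?exprn_ge0//.
have := one (m - n - 3)%N; rewrite subnK// leq_subRL ?addn3//.
by rewrite (leq_trans _ nm)// -addn3 leq_addr.
Qed.

End Chain.

(** * Logarithms, factorials, Poisson weights and nonnegative series *)

Section LogBounds.
Context {R : realType}.

Lemma eln_le (x : \bar R) y : (x <= (expR y)%:E)%E -> (eln x <= y%:E)%E.
Proof.
case: x => [x||]; rewrite ?leye_eq ?leNye// lee_fin /= => xy.
case: ifPn => [x0|]; last by rewrite leNye.
by rewrite lee_fin -ler_expR lnK.
Qed.

Lemma eln_ge (x : \bar R) y : ((expR y)%:E <= x)%E -> (y%:E <= eln x)%E.
Proof.
case: x => [x||]; rewrite ?leey ?leeNy_eq// lee_fin /= => yx.
have x0 : 0 < x := lt_le_trans (expR_gt0 y) yx.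
by rewrite x0 lee_fin -ler_expR lnK.
Qed.

Lemma le_ln_sub1 (x : R) : 0 < x -> ln x <= x - 1.
Proof.
by move=> x0; have := @le_ln1Dx R (x - 1); rewrite [1 + _]addrC subrK; apply; lra.
Qed.

(** Crude Stirling bound [n! <= e * n * (n / e) ^ n]. The induction step amounts to
    [k.+1 * ln (k / k.+1) <= -1]. *)
Lemma ln_fact_le n : (0 < n)%N ->
  ln (n`!%:R : R) <= n.+1%:R * ln n%:R + 1 - n%:R.
Proof.
elim: n => // -[|n] IH _; first by rewrite factS fact0 muln1 ln1 mulr0 add0r subrr.
have {IH} := IH isT; set k := n.+1 => IH.
have k0 : (0 < k%:R :> R) by [].
rewrite factS natrM lnM ?posrE ?ltr0n ?fact_gt0//.
have : ln (k%:R / k.+1%:R : R) <= k%:R / k.+1%:R - 1.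
  by apply: le_ln_sub1; rewrite divr_gt0.
rewrite ln_div ?posrE// => H.
have : k.+1%:R * (ln k%:R - ln k.+1%:R) <= -1 :> R.
  apply: le_trans (ler_wpM2l (ler0n _ _) H) _.
  rewrite le_eqVlt; apply/orP; left; apply/eqP.
  by rewrite -natr1; field; rewrite natr1 pnatr_eq0.
rewrite -[k.+2%:R]natr1; move: IH; rewrite -![k.+1%:R]natr1.
move: (ln (k%:R + 1)) (ln k%:R) => u v; lra.
Qed.

(** The factor [n] lost in the Stirling bound is traded, through [ln (d * n) <= d * n - 1], for a
    loss linear in [n] whose slope [d] can be taken arbitrarily small. *)
Lemma poisson_term_ge (a d : R) n : 0 < a -> 0 < d -> (0 < n)%N ->
  expR (- a + n%:R * (1 - ln (n%:R / a)) - d * n%:R + ln d)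
  <= expR (- a) * a ^+ n / n`!%:R.
Proof.
move=> a0 d0 n0; have n0' : (0 < n%:R :> R) by rewrite ltr0n.
have f0 : (0 < n`!%:R :> R) by rewrite ltr0n fact_gt0.
rewrite -[leRHS]lnK ?posrE ?divr_gt0 ?mulr_gt0 ?expR_gt0 ?exprn_gt0//.
rewrite ler_expR ln_div ?posrE ?mulr_gt0 ?expR_gt0 ?exprn_gt0//.
rewrite lnM ?posrE ?expR_gt0 ?exprn_gt0// expRK lnXn// ln_div ?posrE//.
rewrite -[ln a *+ n]mulr_natl.
have := ln_fact_le n0; rewrite -[n.+1%:R]natr1.
have := @le_ln_sub1 (d * n%:R) (mulr_gt0 d0 n0'); rewrite lnM ?posrE//.
move: (ln n%:R) (ln n`!%:R) (ln a) (ln d) => u v w t.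
lra.
Qed.

Lemma exp_partial_sum_le (x : R) n : 0 <= x ->
  \sum_(0 <= i < n) x ^+ i / i`!%:R <= expR x.
Proof.
move=> x0; rewrite /expR.
apply: (nondecreasing_cvgn_le _ (is_cvg_series_exp_coeff x) n).
by apply: nondecreasing_series => i _ _; exact: exp_coeff_ge0.
Qed.

Lemma nneseries_le (f : nat -> \bar R) K : (forall i, 0 <= f i)%E ->
  (forall n, \sum_(0 <= i < n) f i <= K)%E -> (\sum_(0 <= i <oo) f i <= K)%E.
Proof.
move=> f0 fK; apply: lime_le; first by apply: is_cvg_nneseries => i _ _.
by apply: nearW.
Qed.

Lemma nneseries_ge_term (f : nat -> \bar R) n : (forall i, 0 <= f i)%E ->
  (f n <= \sum_(0 <= i <oo) f i)%E.
Proof.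
move=> f0; apply: le_trans (nneseries_lim_ge n.+1 _) => //.
by rewrite big_nat_recr//= leeDr// sume_ge0.
Qed.

End LogBounds.

(** * Bounds on the law of [xi(T)] at fixed [T] *)

Section XiBounds.
Context {R : realType} (lam mu rho alpha : R).
Hypotheses (lam_gt0 : 0 < lam) (mu_gt0 : 0 < mu) (alpha_gt0 : 0 < alpha).
Hypothesis rhoE : lam / (lam + mu) = rho.

Lemma xi_probE T n : xi_prob lam mu alpha T n =
  (\sum_(0 <= m <oo) (expR (- (alpha * T)) * (alpha * T) ^+ m / m`!%:R *
                      eta_prob lam mu m n)%:E)%E.
Proof. by apply: eq_eseriesr => m _; rewrite (eta_distE lam_gt0 mu_gt0 rhoE). Qed.

Let weight_ge0 (T : R) m n : 0 <= T ->
  0 <= expR (- (alpha * T)) * (alpha * T) ^+ m / m`!%:R * eta_prob lam mu m n.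
Proof.
move=> T0; rewrite mulr_ge0 ?(eta_prob_ge0 lam_gt0 mu_gt0 rhoE)//.
by rewrite divr_ge0// mulr_ge0 ?expR_ge0// exprn_ge0// mulr_ge0// ltW.
Qed.

Lemma xi_prob_ge0 (T : R) n : 0 <= T -> (0 <= xi_prob lam mu alpha T n)%E.
Proof.
by move=> T0; rewrite xi_probE; apply: nneseries_ge0 => m _ _; rewrite lee_fin weight_ge0.
Qed.

Lemma xi_prob_ge (T : R) m n : 0 <= T ->
  ((expR (- (alpha * T)) * (alpha * T) ^+ m / m`!%:R * eta_prob lam mu m n)%:E
   <= xi_prob lam mu alpha T n)%E.
Proof.
move=> T0; rewrite xi_probE.
apply: (@nneseries_ge_term _ (fun m => (expR (- (alpha * T)) *
  (alpha * T) ^+ m / m`!%:R * eta_prob lam mu m n)%:E)) => i.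
by rewrite lee_fin weight_ge0.
Qed.

(* Since [eta_prob m n] vanishes for [m < n], the weights may be multiplied
   by [z ^ (m - n) >= 1] as in Chernoff's bound. *)
Lemma xi_prob_le (T C r z : R) n : 0 <= T -> 0 <= C -> 0 <= r -> 1 <= z ->
  (forall m j, eta_prob lam mu m j <= C * r ^+ j) ->
  (xi_prob lam mu alpha T n <=
   (C * expR (alpha * T * (z - 1)) * (r / z) ^+ n)%:E)%E.
Proof.
move=> T0 C0 r0 z1 etaC; set a := alpha * T.
have a0 : 0 <= a by rewrite mulr_ge0// ltW.
have z0 : 0 < z by exact: lt_le_trans z1.
have z0' := ltW z0.
have alpha0 := ltW alpha_gt0.
rewrite xi_probE; apply: nneseries_le => [m|N].
  by rewrite lee_fin weight_ge0.
rewrite sumEFin lee_fin.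
apply: (@le_trans _ _ (\sum_(0 <= m < N)
    (C * (r / z) ^+ n * expR (- a)) * ((a * z) ^+ m / m`!%:R))).
  apply: ler_sum => m _.
  have [mn|nm] := ltnP m n.
    rewrite (eta_prob_supp lam mu mn) mulr0.
    by rewrite ?mulr_ge0 ?exprn_ge0 ?mulr_ge0 ?expR_ge0 ?invr_ge0.
  apply: le_trans (ler_wpM2l _ (etaC m n)) _.
    by rewrite divr_ge0// mulr_ge0 ?expR_ge0// exprn_ge0.
  have zmn : 1 <= z ^+ m / z ^+ n.
    by rewrite -(subnK nm) exprD mulfK ?gt_eqF ?exprn_gt0// exprn_ege1.
  rewrite -[leLHS]mulr1 [leRHS](_ : _ = expR (- a) * a ^+ m / m`!%:R *
    (C * r ^+ n) * (z ^+ m / z ^+ n)).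
    by rewrite ler_wpM2l// ?mulr_ge0 ?exprn_ge0 ?mulr_ge0 ?expR_ge0 ?invr_ge0.
  by rewrite !exprMn exprVn; ring.
(* What remains is a partial exponential series at [a * z], and [expR (- a) * expR (a * z) = expR (a
   * (z - 1))]. *)
rewrite -mulr_sumr; apply: le_trans (ler_wpM2l _ (exp_partial_sum_le _ _)) _.
- by rewrite ?mulr_ge0 ?exprn_ge0 ?mulr_ge0 ?expR_ge0 ?invr_ge0.
- by rewrite mulr_ge0.
rewrite mulrBr mulr1 [in leRHS]addrC expRD.
by rewrite le_eqVlt; apply/orP; left; apply/eqP; ring.
Qed.

Lemma xiT_prob_ge (phi : R -> R) (T : R) (B : set R) n : 0 <= T -> B (n%:R / phi T) ->
  (xi_prob lam mu alpha T n <= xiT_prob lam mu alpha phi T B)%E.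
Proof.
move=> T0 Bn; rewrite /xiT_prob.
have := @nneseries_ge_term R (fun n =>
  ((\1_B (n%:R / phi T))%:E * xi_prob lam mu alpha T n)%E) n.
rewrite indicE mem_set// mul1e; apply => i.
by rewrite mule_ge0 ?xi_prob_ge0// lee_fin.
Qed.

(** The values [n / phi T] are nonnegative, so they lie in [B] only if [n >= b * phi T], which
    leaves a geometric tail. The factor [1 / s] pays for rounding [b * phi T] down. *)
Lemma xiT_prob_le (phi : R -> R) (T : R) (B : set R) (b K s : R) : 0 <= T -> 0 < phi T -> 0 <= b ->
  (forall x, 0 <= x -> B x -> b <= x) -> 0 <= K -> 0 < s < 1 ->
  (forall n, xi_prob lam mu alpha T n <= (K * s ^+ n)%:E)%E ->
  (xiT_prob lam mu alpha phi T B <=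
   (K / s / (1 - s) * expR (b * phi T * ln s))%:E)%E.
Proof.
move=> T0 phi0 b0 Bb K0 /andP[s0 s1] xiK.
set N := Num.truncn (b * phi T).
have bN : b * phi T - 1 <= N%:R.
  by rewrite lerBlDr natr1 ltW// truncnS_gt.
apply: nneseries_le => [n|n].
  by rewrite mule_ge0 ?xi_prob_ge0// lee_fin.
apply: (@le_trans _ _ (\sum_(0 <= i < n | (N <= i)%N) (K * s ^+ i)%:E)%E).
  rewrite [leRHS]big_mkcond; apply: lee_sum => i _.
  rewrite indicE; case: (boolP (_ \in B)) => [/set_mem Bi|_]; last first.
    by rewrite mul0e; case: ifP => // _; rewrite lee_fin mulr_ge0// exprn_ge0// ltW.
  rewrite mul1e ifT// truncn_le_nat (le_lt_trans (y := i%:R))//; last first.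
    by rewrite ltr_nat.
  by rewrite -ler_pdivlMr// Bb// divr_ge0// ltW.
rewrite sumEFin lee_fin -mulr_sumr -[_ / s / _ * _]mulrA -[_ / s * _]mulrA.
rewrite ler_wpM2l// (le_trans (geometric_tail N n _)) ?s0//.
rewrite mulrC [leRHS]mulrCA ler_wpM2l ?invr_ge0 ?subr_ge0 ?(ltW s1)//.
rewrite ler_pdivlMl// -exprS -[leLHS]lnK ?posrE ?exprn_gt0// ler_expR lnXn//.
rewrite -mulr_natl ler_wnM2r//; first by rewrite ln_le0// ltW.
by rewrite -natr1 -lerBlDr.
Qed.

End XiBounds.

(** * Upper and lower limits from eventual bounds *)

Section LimitBounds.
Context {R : realType}.

Lemma limf_esup_le (f : R -> \bar R) (F : set_system R) l :
  (\forall x \near F, f x <= l)%E -> (limf_esup f F <= l)%E.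
Proof.
move=> fl; rewrite limf_esupE; apply: ge_ereal_inf.
exists (ereal_sup [set f x | x in [set x | (f x <= l)%E]]).
  by exists [set x | (f x <= l)%E].
by apply: ge_ereal_sup => _ [x ? <-].
Qed.

Lemma limf_einf_ge (f : R -> \bar R) (F : set_system R) {FF : Filter F} l :
  (\forall x \near F, l <= f x)%E -> (l <= limf_einf f F)%E.
Proof.
move=> fl; rewrite /limf_einf leeNr; apply: limf_esup_le.
by apply: filterS fl => x; rewrite leeN2.
Qed.

End LimitBounds.

(** * The rate function and its compact sublevel sets *)

Section Rate.
Context {R : realType} (lam mu alpha k : R).
Hypotheses (lam_gt0 : 0 < lam) (mu_gt0 : 0 < mu).
Hypotheses (alpha_gt0 : 0 < alpha) (k_gt0 : 0 < k).

(** Cramér rate function of the Poisson law of mean [b], at [y > 0]. *)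
Definition poisson_rate (b y : R) : R := y * ln (y / b) - y + b.

Lemma poisson_rate_ge0 (b y : R) : 0 < b -> 0 < y -> 0 <= poisson_rate b y.
Proof.
move=> b0 y0; rewrite /poisson_rate.
have := @le_ln_sub1 R (b / y) (divr_gt0 b0 y0).
rewrite !ln_div ?posrE// => /(ler_wpM2l (ltW y0)).
by rewrite [leRHS]mulrBr mulr1 mulrCA divff ?gt_eqF// mulr1; lra.
Qed.

(** Both finite branches at once: the Poisson cost of the number of steps plus the cost of the
    height [x]. Below [alpha / k] the maximum is [alpha / k], where the Poisson cost is 0. *)
Lemma J_rateE (x : R) : 0 <= x -> J_rate lam mu alpha k x =
  (poisson_rate (alpha / k) (Num.max x (alpha / k)) - x * ln (lam / (lam + mu)))%:E.
Proof.
move=> x0; have lm0 : 0 < lam + mu by exact: addr_gt0.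
rewrite /J_rate ltNge x0/= /poisson_rate.
have b0 : 0 < alpha / k by exact: divr_gt0.
case: ltP => [xb|bx].
  by rewrite divff ?gt_eqF// ln1 !ln_div ?posrE//; congr (_%:E); lra.
have {x0}x0 : 0 < x by exact: lt_le_trans bx.
rewrite !(ln_div, lnM) ?posrE ?mulr_gt0 ?invr_gt0 ?mulr_gt0//.
by congr (_%:E); lra.
Qed.

(** The finite part of the rate is continuous, so sublevel sets are closed; as the Poisson cost is
    nonnegative, they lie in [[0, c / - ln rho]] with [rho = lam / (lam + mu)]. *)
Lemma compact_J_rate (c : R) : compact [set x | (J_rate lam mu alpha k x <= c%:E)%E].
Proof.
have b0 : 0 < alpha / k by exact: divr_gt0.
have lm0 : 0 < lam + mu by exact: addr_gt0.
have L0 : ln (lam / (lam + mu)) < 0.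
  by rewrite ln_lt0// divr_gt0//= ltr_pdivrMr// mul1r ltrDl.
pose F (x : R) := poisson_rate (alpha / k) (Num.max x (alpha / k)) -
  x * ln (lam / (lam + mu)).
have JF : [set x | (J_rate lam mu alpha k x <= c%:E)%E] =
    [set x | 0 <= x] `&` F @^-1` [set y | y <= c].
  apply/seteqP; split=> x /=.
    have [x0|x0] := ltP x 0; first by rewrite /J_rate x0 leye_eq.
    by rewrite J_rateE.
  by move=> [x0]; rewrite J_rateE.
have maxC : continuous (fun x : R => Num.max x (alpha / k)).
  move=> x; apply: (@continuous_max R R id (cst (alpha / k)) x).
    exact: cvg_id.
  exact: cvg_cst.
have FC : continuous F.
  move=> x; apply: cvgB; last by apply: cvgMr_tmp; exact: cvg_id.
  apply: cvgD; last exact: cvg_cst.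
  apply: cvgB; last exact: maxC.
  apply: cvgM; first exact: maxC.
  apply: continuous_cvg.
    by apply: continuous_ln; rewrite divr_gt0// lt_max b0 orbT.
  by apply: cvgMr_tmp; exact: maxC.
rewrite JF; apply: (@subclosed_compact _ _ `[0, c / - ln (lam / (lam + mu))]).
- apply: closedI; first exact: closed_ge.
  by apply: preimage_closed => [x _|]; [exact: FC|exact: closed_le].
- exact: segment_compact.
move=> x [/= x0 Fx]; rewrite in_itv/= x0/= ler_pdivlMr ?oppr_gt0//.
have := @poisson_rate_ge0 (alpha / k) (Num.max x (alpha / k)) b0.
rewrite lt_max b0 orbT => /(_ isT); move: Fx; rewrite /F; lra.
Qed.

End Rate.

(** * Asymptotic upper and lower bounds on the scale [phi] *)

Section LDPBounds.
Context {R : realType} (lam mu rho alpha k : R) (phi : R -> R).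
Hypotheses (lam_gt0 : 0 < lam) (mu_gt0 : 0 < mu).
Hypotheses (alpha_gt0 : 0 < alpha) (k_gt0 : 0 < k).
Hypothesis rhoE : lam / (lam + mu) = rho.
Hypothesis phi_gt0 : forall T, 0 < T -> 0 < phi T.
Hypothesis phi_pinfty : phi x @[x --> +oo] --> +oo.
Hypothesis phi_equiv : (phi x / x) @[x --> +oo] --> k.

Let rho_gt0 : 0 < rho.
Proof. by rewrite -rhoE divr_gt0// addr_gt0. Qed.

Let rho_lt1 : rho < 1.
Proof. by rewrite -rhoE ltr_pdivrMr ?addr_gt0// mul1r ltrDl. Qed.

Let beta_gt0 : 0 < alpha / k. Proof. exact: divr_gt0. Qed.

Let near_gt0 : \forall T \near +oo, 0 < T :> R.
Proof. exact: nbhs_pinfty_gt. Qed.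

Let near_phi_gt0 : \forall T \near +oo, 0 < phi T.
Proof. by apply: filterS near_gt0 => T; exact: phi_gt0. Qed.

Lemma cvg_invphi : (phi T)^-1 @[T --> +oo] --> (0 : R).
Proof. by apply/gtr0_cvgV0. Qed.

Lemma cvg_ratio : alpha * T / phi T @[T --> +oo] --> alpha / k.
Proof.
have : alpha * (phi T / T)^-1 @[T --> +oo] --> alpha / k.
  by apply: cvgMl_tmp; exact: cvgV (lt0r_neq0 k_gt0) phi_equiv.
apply: cvg_trans.
by apply: near_eq_cvg; near=> T; rewrite /= invf_div mulrA.
Unshelve. all: by end_near. Qed.

Lemma cvg_truncn (x : R) : 0 <= x ->
  (Num.truncn (x * phi T))%:R / phi T @[T --> +oo] --> x.
Proof.
move=> x0; apply: (@squeeze_cvgr _ _ _ _ (fun T => x - (phi T)^-1) (cst x)).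
- apply: filterS near_phi_gt0 => T p0 /=.
  have xp0 : 0 <= x * phi T by rewrite mulr_ge0// ltW.
  rewrite ler_pdivrMr// ler_pdivlMr// truncn_le xp0 andbT.
  by rewrite mulrBl mulVf ?gt_eqF// lerBlDr natr1 ltW// truncnS_gt.
- rewrite -[X in _ --> X]subr0; apply: cvgB; first exact: cvg_cst.
  exact: cvg_invphi.
- exact: cvg_cst.
Qed.

(** The tilt [z] minimizes the Chernoff exponent [alpha / k * (z - 1) - b * ln z] over [z >= 1]. *)
Lemma xiT_upper (B : set R) (b e : R) : 0 <= b -> 0 < e ->
  (forall x, 0 <= x -> B x -> b <= x) ->
  \forall T \near +oo,
    (((phi T)^-1)%:E * eln (xiT_prob lam mu alpha phi T B) <=
     - J_rate lam mu alpha k b + e%:E)%E.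
Proof.
move=> b0 e0 Bb; rewrite J_rateE// rhoE -EFinN -EFinD.
set y := Num.max b (alpha / k).
have yb : alpha / k <= y by rewrite le_max lexx orbT.
have y0 : 0 < y by exact: lt_le_trans yb.
(* Either [y = b], or [y = alpha / k] and both logarithms vanish. *)
have by_ : b * ln (y / (alpha / k)) = y * ln (y / (alpha / k)).
  rewrite /y; case: (leP b (alpha / k)) => // _.
  by rewrite divff ?gt_eqF// ln1 !mulr0.
have lnrho : ln rho < 0 by rewrite ln_lt0// rho_gt0.
pose z := y / (alpha / k).
have z1 : 1 <= z by rewrite ler_pdivlMr// mul1r.
have z0 : 0 < z by exact: lt_le_trans z1.
(* The decay rate is [r = rho * expR d]: the first bound on [d] gives [r < 1], the second keeps the
   loss [b * d] below [e]. *)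
pose d := Num.min (- ln rho / 2) (e / (b + 1) / 2).
have d0 : 0 < d.
  by rewrite lt_min !divr_gt0 ?oppr_gt0// ltr_wpDl.
have d_rho : ln rho + d < 0.
  have : d <= - ln rho / 2 by rewrite ge_min lexx.
  by lra.
have d_e : b * d < e.
  have : d <= e / (b + 1) / 2 by rewrite ge_min lexx orbT.
  have b1 : 0 < b + 1 by rewrite ltr_wpDl.
  move=> /(ler_wpM2l (ltW b1)); rewrite mulrA mulrCA divff ?gt_eqF// mulr1.
  by nra.
pose r := expR (ln rho + d).
have rho_r : rho < r < 1.
  by rewrite -expR0 ltr_expR d_rho andbT -[ltLHS]lnK ?posrE// ltr_expR ltrDl.
have [C C0 HC] := eta_prob_le lam_gt0 mu_gt0 rhoE rho_r.
pose s := r / z.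
have s0 : 0 < s by rewrite divr_gt0// expR_gt0.
have s1 : s < 1.
  by rewrite ltr_pdivrMr// mul1r (lt_le_trans _ z1)//; case/andP: rho_r.
have lns : ln s = ln rho + d - ln z by rewrite ln_div ?posrE ?expR_gt0// expRK.
pose K := C / s / (1 - s).
have K0 : 0 < K by rewrite divr_gt0 ?subr_gt0// divr_gt0.
(* [u T] is the logarithm of the bound of [xiT_prob_le], divided by [phi T]. *)
pose u T := ln K * (phi T)^-1 + alpha * T / phi T * (z - 1) + b * ln s.
have ucvg : u T @[T --> +oo] --> ln K * 0 + alpha / k * (z - 1) + b * ln s.
  apply: cvgD; last exact: cvg_cst.
  apply: cvgD; first by apply: cvgMl_tmp; exact: cvg_invphi.
  by apply: cvgMr_tmp; exact: cvg_ratio.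
have ulim : ln K * 0 + alpha / k * (z - 1) + b * ln s <
    - (poisson_rate (alpha / k) y - b * ln rho) + e.
  rewrite mulrBr mulr1 lns [_ * z]mulrC /z divfK ?gt_eqF// mulrBr mulrDr by_.
  by rewrite /poisson_rate; lra.
near=> T.
have T0 : 0 < T by near: T; exact: near_gt0.
have p0 : 0 < phi T by exact: phi_gt0.
apply: (@le_trans _ _ (u T)%:E); last first.
  by rewrite lee_fin ltW//; near: T; exact: cvgr_lt ucvg _ ulim.
have -> : u T = (phi T)^-1 * (ln K + alpha * T * (z - 1) + b * phi T * ln s).
  by rewrite /u; field; rewrite !gt_eqF.
rewrite EFinM; apply: lee_wpmul2l; first by rewrite lee_fin invr_ge0 ltW.
apply: eln_le; rewrite 2!expRD lnK ?posrE//.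
have xiC n := xi_prob_le lam_gt0 mu_gt0 alpha_gt0 rhoE n (ltW T0) (ltW C0)
  (ltW (expR_gt0 _)) z1 HC.
have := xiT_prob_le lam_gt0 mu_gt0 alpha_gt0 rhoE (ltW T0) p0 b0 Bb _ _ xiC.
rewrite s0 s1 => /(_ _ isT).
have K0' : 0 <= C * expR (alpha * T * (z - 1)).
  by rewrite mulr_ge0 ?expR_ge0// ltW.
move=> /(_ K0')/le_trans; apply; rewrite lee_fin.
by rewrite le_eqVlt; apply/orP; left; apply/eqP; rewrite /K; ring.
Unshelve. all: by end_near. Qed.

(** A single term suffices: [m T ~ y * phi T] Poisson events and final state [(n T).+1 ~ x * phi T],
    which after scaling is eventually in the neighbourhood [B] of [x]. *)
Lemma xiT_lower (B : set R) (x e : R) : 0 <= x -> 0 < e -> nbhs x B ->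
  \forall T \near +oo,
    (- J_rate lam mu alpha k x - e%:E <=
     ((phi T)^-1)%:E * eln (xiT_prob lam mu alpha phi T B))%E.
Proof.
move=> x0 e0 Bx; rewrite J_rateE// rhoE -EFinN -EFinB.
set y := Num.max x (alpha / k).
have yb : alpha / k <= y by rewrite le_max lexx orbT.
have xy : x <= y by rewrite le_max lexx.
have y0 : 0 < y by exact: lt_le_trans yb.
have [c c0 Hc] := eta_prob_ge lam_gt0 mu_gt0 rhoE.
(* Slope of the loss in [poisson_term_ge]; in the limit it costs [d * y < e]. *)
pose d := e / (y + 1).
have d0 : 0 < d by rewrite divr_gt0// addr_gt0.
have dy : d * y < e by rewrite mulrAC ltr_pdivrMr ?addr_gt0// ltr_pM2l// ltrDl.
pose n T := Num.truncn (x * phi T).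
(* The 3 extra steps, with [x <= y], give the [(n T).+3 <= m T] that [eta_prob_ge] asks for. *)
pose m T := ((Num.truncn (y * phi T)) + 3)%N.
have ncvg : (n T)%:R / phi T @[T --> +oo] --> x by exact: cvg_truncn.
have n1cvg : (n T).+1%:R / phi T @[T --> +oo] --> x.
  rewrite -[X in _ --> X]addr0.
  under eq_fun do rewrite -natr1 mulrDl mul1r.
  by apply: cvgD => //; exact: cvg_invphi.
have mcvg : (m T)%:R / phi T @[T --> +oo] --> y.
  rewrite -[X in _ --> X]addr0 -(mulr0 3%:R).
  under eq_fun do rewrite natrD mulrDl.
  by apply: cvgD; [exact: cvg_truncn (ltW y0)|apply: cvgMl_tmp; exact: cvg_invphi].
pose u T := (ln c + ln d) * (phi T)^-1 + (n T)%:R / phi T * ln rho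
  - alpha * T / phi T
  + (m T)%:R / phi T * (1 - ln (((m T)%:R / phi T) / (alpha * T / phi T)))
  - d * ((m T)%:R / phi T).
have ucvg : u T @[T --> +oo] --> (ln c + ln d) * 0 + x * ln rho
    - alpha / k + y * (1 - ln (y / (alpha / k))) - d * y.
  apply: cvgB; last exact: cvgMl_tmp.
  apply: cvgD; last first.
    apply: cvgM => //; apply: cvgB; first exact: cvg_cst.
    apply: continuous_cvg; first by apply: continuous_ln; rewrite divr_gt0.
    by apply: cvgM => //; apply: cvgV; [rewrite gt_eqF|exact: cvg_ratio].
  apply: cvgB; last exact: cvg_ratio.
  apply: cvgD; first by apply: cvgMl_tmp; exact: cvg_invphi.
  exact: cvgMr_tmp.
have ulim : - (poisson_rate (alpha / k) y - x * ln rho) - e <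
    (ln c + ln d) * 0 + x * ln rho
    - alpha / k + y * (1 - ln (y / (alpha / k))) - d * y.
  by rewrite /poisson_rate; lra.
near=> T.
have T0 : 0 < T by near: T; exact: near_gt0.
have p0 : 0 < phi T by exact: phi_gt0.
have a0 : 0 < alpha * T by exact: mulr_gt0.
have m0 : (0 < m T)%N by rewrite /m addnS.
apply: (@le_trans _ _ (u T)%:E).
  by rewrite lee_fin ltW//; near: T; exact: cvgr_gt ucvg _ ulim.
have -> : u T = (phi T)^-1 * (ln c + (n T)%:R * ln rho +
    (- (alpha * T) + (m T)%:R * (1 - ln ((m T)%:R / (alpha * T)))
     - d * (m T)%:R + ln d)).
  rewrite /u (_ : (m T)%:R / phi T / (alpha * T / phi T) = (m T)%:R / (alpha * T)).
    by field; rewrite !gt_eqF.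
  by field; rewrite !gt_eqF.
rewrite EFinM; apply: lee_wpmul2l; first by rewrite lee_fin invr_ge0 ltW.
apply: eln_ge.
have BnT : B ((n T).+1%:R / phi T) by near: T; exact: n1cvg.
apply: le_trans (xiT_prob_ge lam_gt0 mu_gt0 alpha_gt0 rhoE (ltW T0) BnT).
apply: le_trans (xi_prob_ge lam_gt0 mu_gt0 alpha_gt0 rhoE (m T) (n T).+1 (ltW T0)).
rewrite lee_fin [leRHS]mulrC expRD ler_pM ?expR_ge0//; last exact: poisson_term_ge.
rewrite expRD lnK ?posrE// mulrC -mulrC expRM_natl lnK ?posrE//.
apply: Hc; rewrite /m addn3 !ltnS /n le_truncn// ler_wpM2r// ltW.
Unshelve. all: by end_near. Qed.

End LDPBounds.

(** * Assembling the large deviation principle *)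

Lemma closure_inf {R : realType} (A : set R) : has_inf A -> closure A (inf A).
Proof.
move=> Ainf U /nbhs_ballP[e /= e0 eU].
have [x Ax xe] := inf_adherent e0 Ainf.
exists x; split=> //; apply: eU; rewrite /ball/= distrC ger0_norm.
  by rewrite ltrBlDl.
by rewrite subr_ge0 ge_inf//; case: Ainf.
Qed.

Theorem theorem2p2 (R : realType) (lam mu alpha k : R) (phi : R -> R) :
  0 < lam -> 0 < mu -> 0 < alpha -> 0 < k ->
  (forall T, 0 < T -> 0 < phi T) ->
  phi x @[x --> +oo] --> +oo ->
  (phi x / x) @[x --> +oo] --> k ->
  LDP (fun T B => xiT_prob lam mu alpha phi T B) (J_rate lam mu alpha k) phi.
Proof.
move=> lam0 mu0 alpha0 k0 phi0 phiy phik.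
split=> [c _|B _]; first exact: compact_J_rate.
split; last first.
  (* The lower bound is checked at each interior point; negative ones have infinite rate. *)
  rewrite leeNl; apply: le_ereal_inf_tmp => _ [x Bx <-]; rewrite leeNl.
  have [x0|x0] := ltP x 0; first by rewrite /J_rate x0 leNye.
  apply/lee_addgt0Pr => e e0; rewrite -leeBlDr//; apply: limf_einf_ge.
  exact: (xiT_lower lam0 mu0 alpha0 k0 erefl phi0 phiy phik x0 e0 Bx).
(* Only the nonnegative part of [B] can be charged; if it is empty, the probability is 0 and its
   logarithm [-oo]. *)
pose A := B `&` [set x | 0 <= x].
have [A0|/set0P A0] := eqVneq A set0.
  apply: limf_esup_le; apply: filterS (nbhs_pinfty_gt (num_real 0)) => T T0.
  have -> : xiT_prob lam mu alpha phi T B = 0%E.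
    rewrite /xiT_prob eseries0// => n _ _.
    rewrite indicE memNset ?mul0e// => Bn.
    suff : A (n%:R / phi T) by rewrite A0.
    by split=> //=; rewrite divr_ge0// ltW// phi0.
  by rewrite /= ltxx gt0_muleNy ?leNye// lte_fin invr_gt0 phi0.
have lbA : lbound A 0 by move=> x [].
have Ainf : has_inf A by split=> //; exists 0.
have infA0 : 0 <= inf A by exact: lb_le_inf.
apply/lee_addgt0Pr => e e0.
apply: (@le_trans _ _ (- J_rate lam mu alpha k (inf A) + e%:E)%E).
  apply: limf_esup_le.
  apply: (xiT_upper lam0 mu0 alpha0 k0 erefl phi0 phiy phik infA0 e0) => x x0 Bx.
  by apply: ge_inf => //; exists 0.
(* [inf A] lies in the closure of [B], so the infimum of the rate there is at most its value at
   [inf A]. *)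
rewrite leeD2r// leeN2; apply: ereal_inf_lbound; exists (inf A) => //.
by have [] := closureI (closure_inf Ainf).
Qed.
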